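(* For $p\in\{21,12,132,213,123\}$ let $L_p(x)$ be the generating function in which the coefficient of $x^n$ ($n\ge0$) is the popularity of the consecutive pattern $p$ in the set $\mathcal{P}_n$ of faro permutations of length $n$, i.e. the total number of occurrences of $p$ over all permutations in $\mathcal{P}_n$. Then $$L_{21}(x)=\frac{1-\sqrt{1-4x^2}}{2(1-2x)\sqrt{1-4x^2}},$$ $$L_{12}(x)=\frac{2x\left(-1+4x^2+x+\sqrt{1-4x^2}\right)}{(1-2x)(1+\sqrt{1-4x^2})\sqrt{1-4x^2}},$$ $$L_{132}(x)=L_{213}(x)=\frac{x\left(-1+4x^2+2x+(1-2x)\sqrt{1-4x^2}\right)}{(1-2x)(1+\sqrt{1-4x^2})\sqrt{1-4x^2}},$$ $$L_{123}(x)=\frac{x(1+2x)(1-\sqrt{1-4x^2})}{(1-2x)(1+\sqrt{1-4x^2})}.$$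
   Context: A faro permutation of length $n$ is a permutation $w=w_1\cdots w_n$ of $\{1,\dots,n\}$ obtained by interlacing two increasing words $u,v$ as $u_1v_1u_2v_2\cdots$ with $0\le|u|-|v|\le1$ (equivalently, $w_i<w_{i+2}$ for all $1\le i\le n-2$). An occurrence of a consecutive pattern $p=p_1\cdots p_m$ in $w$ is a factor $w_iw_{i+1}\cdots w_{i+m-1}$ order-isomorphic to $p$. Generating functions are formal power series and square roots denote the branch with constant term $1$. *)

(* Defs.v *)
From HB Require Import structures.
From mathcomp Require Import all_boot all_order all_algebra.
From mathcomp Require Import boolp.

Set Implicit Arguments.
Unset Strict Implicit.
Unset Printing Implicit Defensive.

Import GRing.Theory.
Local Open Scope ring_scope.

(* A wrapper is used because [nat -> K] itself carries the pointwise ring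
   structure. *)
Record fps (K : fieldType) := Fps { fcoef : nat -> K }.
Arguments Fps {K}.

HB.instance Definition _ (K : fieldType) := gen_eqMixin (fps K).
HB.instance Definition _ (K : fieldType) := gen_choiceMixin (fps K).

Section Fps.
Variable K : fieldType.
Implicit Types f g h : fps K.

Lemma fpsP f g : fcoef f =1 fcoef g -> f = g.
Proof. by case: f g => [f] [g] /= /funext ->. Qed.

Definition fps0 : fps K := Fps (fun=> 0).
Definition fps1 : fps K := Fps (fun n => (n == 0)%:R).
Definition fpsX : fps K := Fps (fun n => (n == 1)%:R).
Definition fps_opp f := Fps (fun n => - fcoef f n).
Definition fps_add f g := Fps (fun n => fcoef f n + fcoef g n).
Definition fps_mul f g :=
  Fps (fun n => \sum_(i < n.+1) fcoef f i * fcoef g (n - i)%N).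

Fact fps_addA : associative fps_add.
Proof. by move=> f g h; apply: fpsP => n /=; rewrite addrA. Qed.
Fact fps_addC : commutative fps_add.
Proof. by move=> f g; apply: fpsP => n /=; rewrite addrC. Qed.
Fact fps_add0 : left_id fps0 fps_add.
Proof. by move=> f; apply: fpsP => n /=; rewrite add0r. Qed.
Fact fps_addN : left_inverse fps0 fps_opp fps_add.
Proof. by move=> f; apply: fpsP => n /=; rewrite addNr. Qed.

HB.instance Definition _ := GRing.isZmodule.Build (fps K)
  fps_addA fps_addC fps_add0 fps_addN.

Definition ftrunc m f : {poly K} := \poly_(i < m) fcoef f i.

Lemma fps_mul_trunc m f g n : (n < m)%N ->
  fcoef (fps_mul f g) n = (ftrunc m f * ftrunc m g)`_n.
Proof.
move=> ltnm; rewrite coefM; apply: eq_bigr => i _; rewrite !coef_poly.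
have leim : (i < m)%N by rewrite (leq_trans (ltn_ord i)).
by rewrite leim (leq_ltn_trans (leq_subr _ _) ltnm).
Qed.

Fact fps_mulC : commutative fps_mul.
Proof.
by move=> f g; apply: fpsP => n; rewrite !(@fps_mul_trunc n.+1) // mulrC.
Qed.

Fact fps_mulA : associative fps_mul.
Proof.
move=> f g h; apply: fpsP => n.
transitivity (ftrunc n.+1 f * (ftrunc n.+1 g * ftrunc n.+1 h))`_n.
  rewrite coefM; apply: eq_bigr => i _; rewrite coef_poly ltn_ord.
  by rewrite (@fps_mul_trunc n.+1) // ltnS leq_subr.
rewrite mulrA coefM; apply: eq_bigr => i _.
by rewrite coef_poly ltnS leq_subr (@fps_mul_trunc n.+1).
Qed.

Fact fps_mul1 : left_id fps1 fps_mul.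
Proof.
move=> f; apply: fpsP => n /=; rewrite big_ord_recl /= mul1r subn0.
by rewrite big1 ?addr0 // => i _; rewrite mul0r.
Qed.

Fact fps_mulDl : left_distributive fps_mul fps_add.
Proof.
move=> f g h; apply: fpsP => n /=; rewrite -big_split /=.
by apply: eq_bigr => i _; rewrite mulrDl.
Qed.

Fact fps1_neq0 : fps1 != 0.
Proof. by apply/eqP => /(congr1 (fun h : fps K => fcoef h 0)) /= /eqP; rewrite oner_eq0. Qed.

HB.instance Definition _ := GRing.Zmodule_isComNzRing.Build (fps K)
  fps_mulA fps_mulC fps_mul1 fps_mulDl fps1_neq0.

Lemma fcoef0 n : fcoef (0 : fps K) n = 0. Proof. by []. Qed.
Lemma fcoef1 n : fcoef (1 : fps K) n = (n == 0)%:R. Proof. by []. Qed.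
Lemma fcoefD f g n : fcoef (f + g) n = fcoef f n + fcoef g n.
Proof. by []. Qed.
Lemma fcoefN f n : fcoef (- f) n = - fcoef f n. Proof. by []. Qed.
Lemma fcoefM f g n :
  fcoef (f * g) n = \sum_(i < n.+1) fcoef f i * fcoef g (n - i)%N.
Proof. by []. Qed.

(* Course-of-values recursion: the coefficient of index [n] is computed by [F]
   from the list of the [n] previous coefficients. *)
Definition prefix_rec (F : seq K -> K) n : seq K :=
  iter n (fun s => rcons s (F s)) [::].
Definition fps_rec (F : seq K -> K) : fps K := Fps (fun n => F (prefix_rec F n)).

Lemma fps_recE F n : fcoef (fps_rec F) n = F (mkseq (fcoef (fps_rec F)) n).
Proof.
rewrite [LHS]/=; congr F; elim: n => // n IHn.
by rewrite mkseqS -IHn.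
Qed.

Definition fps_inv_rec f (s : seq K) : K :=
  if size s == 0 then (fcoef f 0)^-1
  else - (fcoef f 0)^-1 * \sum_(i < size s) s`_i * fcoef f (size s - i)%N.

Definition fps_unit : pred (fps K) := fun f => fcoef f 0 != 0.
Definition fps_inv f := if fps_unit f then fps_rec (fps_inv_rec f) else f.

Fact fps_mulVf : {in fps_unit, left_inverse 1 fps_inv *%R}.
Proof.
move=> f uf; have f0 : fcoef f 0 != 0 by [].
rewrite /fps_inv /fps_unit f0.
set g := fps_rec _; apply: fpsP => n; rewrite fcoefM fcoef1.
have -> : \sum_(i < n.+1) fcoef g i * fcoef f (n - i) =
          \sum_(i < n) fcoef g i * fcoef f (n - i) + fcoef g n * fcoef f 0.
  by rewrite big_ord_recr subnn.
rewrite [fcoef g n]fps_recE -/g /fps_inv_rec size_mkseq.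
case: eqP => [->|_]; first by rewrite big_ord0 add0r mulVf.
rewrite mulrAC mulNr mulVf // mulN1r; apply/eqP; rewrite subr_eq0; apply/eqP.
by apply: eq_bigr => i _; rewrite nth_mkseq.
Qed.

Fact fps_unitP f g : g * f = 1 -> fps_unit f.
Proof.
move/(congr1 (fun h : fps K => fcoef h 0)); rewrite fcoefM big_ord1 fcoef1 eqxx => gf.
by apply/eqP => f0; move/eqP: gf; rewrite f0 mulr0 eq_sym oner_eq0.
Qed.

Fact fps_inv_out : {in [predC fps_unit], fps_inv =1 id}.
Proof. by move=> f /negbTE uf; rewrite /fps_inv -[fps_unit f]/(f \in fps_unit) uf. Qed.

HB.instance Definition _ := GRing.ComNzRing_hasMulInverse.Build (fps K)
  fps_mulVf fps_unitP fps_inv_out.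

Lemma fps_unitE f : (f \is a GRing.unit) = (fcoef f 0 != 0).
Proof. by []. Qed.

(* The square root with constant term 1, for [f] with constant term 1: its
   coefficients solve [2 s_n + \sum_(0 < i < n) s_i s_(n-i) = f_n]. *)
Definition fps_sqrt_rec f (s : seq K) : K :=
  if size s == 0 then 1
  else (fcoef f (size s) - \sum_(1 <= i < size s) s`_i * s`_(size s - i)) / 2.
Definition fps_sqrt f := fps_rec (fps_sqrt_rec f).

Lemma fps_sqrt_coef0 f : fcoef (fps_sqrt f) 0 = 1.
Proof. by []. Qed.

Lemma sqr_fps_sqrt f : 2 != 0 :> K -> fcoef f 0 = 1 -> fps_sqrt f ^+ 2 = f.
Proof.
move=> nz2 f0; apply: fpsP => -[|n].
  by rewrite expr2 fcoefM big_ord1 fps_sqrt_coef0 mulr1 f0.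
rewrite expr2 fcoefM; set s := fps_sqrt f.
have -> : \sum_(i < n.+2) fcoef s i * fcoef s (n.+1 - i) =
    fcoef s n.+1 + (\sum_(0 <= i < n) fcoef s i.+1 * fcoef s (n.+1 - i.+1)
                    + fcoef s n.+1).
  rewrite big_ord_recl big_ord_recr big_mkord; congr (_ + (_ + _)).
    by rewrite subn0 mul1r.
  by rewrite lift0 subnn mulr1.
have -> : fcoef s n.+1 =
    (fcoef f n.+1 - \sum_(0 <= i < n) fcoef s i.+1 * fcoef s (n.+1 - i.+1)%N) / 2.
  rewrite [LHS]fps_recE /fps_sqrt_rec size_mkseq big_add1.
  congr ((_ - _) / 2); apply: eq_big_nat => i /andP[_ ltin].
  by rewrite subSS !nth_mkseq ?ltnS ?leq_subr.
by rewrite addrCA -mulrDl -mulr2n -[(_ - _) *+ _]mulr_natr mulfK // addrC subrK.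
Qed.

Lemma fps_sqrt_uniq f s : 2 != 0 :> K ->
  fcoef s 0 = 1 -> s ^+ 2 = f -> s = fps_sqrt f.
Proof.
move=> nz2 s0 sf; have f0 : fcoef f 0 = 1.
  by rewrite -sf expr2 fcoefM big_ord1 s0 mulr1.
have u : s + fps_sqrt f \is a GRing.unit.
  by rewrite fps_unitE fcoefD s0 fps_sqrt_coef0.
apply/eqP; rewrite -subr_eq0 -(mulIr_eq0 _ (mulIr u)) -subr_sqr sf.
by rewrite sqr_fps_sqrt // subrr.
Qed.

End Fps.

Arguments fpsX {K}.

(* Permutations of {1, ..., n} are represented by their words. *)

Local Open Scope nat_scope.

(* u_1 v_1 u_2 v_2 ... *)
Fixpoint interlace (u v : seq nat) : seq nat :=
  match u, v with
  | a :: u', b :: v' => a :: b :: interlace u' v'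
  | [::], _ => v
  | _, [::] => u
  end.

Definition is_faro (w : seq nat) : Prop :=
  exists u v : seq nat,
    [/\ sorted ltn u, sorted ltn v, size v <= size u <= (size v).+1
      & w = interlace u v].

Definition faro_perms (n : nat) : seq (seq nat) :=
  [seq w <- permutations (iota 1 n) | `[< is_faro w >]].

Definition order_iso (s t : seq nat) : bool :=
  (size s == size t) &&
  all (fun i => all (fun j => (nth 0 s i < nth 0 s j) == (nth 0 t i < nth 0 t j))
                    (iota 0 (size s)))
      (iota 0 (size s)).

(* Positions too close to the end of [w] yield factors that are shorter than [p],
   which are never order-isomorphic to it. *)
Definition occurrences (p w : seq nat) : nat :=
  count (fun i => order_iso (take (size p) (drop i w)) p) (iota 0 (size w).+1).

Definition popularity (p : seq nat) (n : nat) : nat :=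
  \sum_(w <- faro_perms n) occurrences p w.

Definition popularity_gf (p : seq nat) : fps rat :=
  Fps (fun n => (popularity p n)%:R%R).

(* Main.v *)
Require Import Defs.
From mathcomp Require Import all_boot all_order all_algebra.
From mathcomp Require Import boolp zify ring lra.

Import GRing.Theory.
Local Open Scope ring_scope.

(** A faro permutation [w] of length [n] is determined by the pair [(u, v)] of
    its two increasing words, that is, by a subset of [uphalf n] letters of
    [1..n]; so there are ['C(n, n./2)] of them.  Write [M n] for this number and
    [D n] for the popularity of [21], the total number of descents.

    Everything reduces to [D] and [M].  Since [w_i < w_(i+2)], a factor of
    length 3 of [w] can only be [123], [132] or [213]; it is a [132] exactly
    when its last step is a descent, and a [213] exactly when its first step is
    one.  So an occurrence of [132] is a descent which is not at the first
    position, and an occurrence of [213] is one which is not at the last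
    position ([occurrences132], [occurrences213]).  The first position is a
    descent unless 1 comes first, and the last one unless the maximum comes
    last ([head_descent], [last_descent]); either exception concerns [M (n - 1)]
    permutations.  The patterns [12] and [123] take the remaining factors.

    To compute [D], drop the constraint on the sizes of [u] and [v]: for pairs
    with [size u = a], appending the maximum to [u] or to [v] creates at most one
    descent, and only the sizes tell whether it does.  The resulting recurrence
    ([descent_totalS]) is that of a lattice path statistic and is solved by
    [m * 'C(n, a) - \sum_(j < m) 'C(n, j)], where [m = minn a (n - a)]
    ([descent_totalE]).  In the balanced case the sum is half of [2 ^ n] up to
    the middle term, whence [2 * D n + 2 ^ n = n.+1 * M n]
    ([popularity21_closed]).

    On the side of generating functions, let [r] be the square root of
    [1 - 4 x^2] and [z = 2 x / (1 + r)], the solution of [z = x (1 + z^2)].  The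
    binomials ['C(n, uphalf (n + h))] and the coefficients of
    [z^h (1 + z) / r] satisfy the same recurrence in [n], which is Pascal's rule
    ([coef_walk_gf]).  For [h = 0] this gives the series of [M], and the
    identity [D (n + 2) = 4 D n + M (n + 1)] gives that of [D].  The four formulas
    are then rational identities in [x], [r] and [z]. *)

(** * Faro permutations as pairs of increasing words *)

Local Open Scope nat_scope.

(** The pairs of increasing words whose letters are together [1..n] (see
    [mem_splits]), without any condition on their sizes: this is what makes
    induction on [n], by removal of the maximum, possible. *)
Fixpoint splits n : seq (seq nat * seq nat) :=
  if n is m.+1 then
    [seq (rcons p.1 m.+1, p.2) | p <- splits m]
      ++ [seq (p.1, rcons p.2 m.+1) | p <- splits m]
  else [:: ([::], [::])].

Lemma sorted_ltn_rcons s x :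
  sorted ltn (rcons s x) = sorted ltn s && all (ltn^~ x) s.
Proof.
rewrite !(sorted_pairwise ltn_trans) -cats1 pairwise_cat /= andbT andbC.
congr andb; rewrite allrelC allrel1l; exact: eq_all.
Qed.

Lemma sorted_max s x : sorted ltn s -> all (leq^~ x) s -> x \in s ->
  exists2 s', s = rcons s' x & sorted ltn s'.
Proof.
case/lastP: s => // s y; rewrite sorted_ltn_rcons all_rcons mem_rcons inE.
move=> /andP[s_sorted /allP s_lt] /andP[/= le_y _] /predU1P[->|/s_lt /=]; last lia.
by exists s.
Qed.

Lemma mem_splits n u v :
  ((u, v) \in splits n) =
  [&& sorted ltn u, sorted ltn v & perm_eq (u ++ v) (iota 1 n)].
Proof.
have bounded m (w : seq nat) : perm_eq w (iota 1 m) -> all (leq^~ m) w.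
  by move=> /perm_all ->; apply/allP=> y; rewrite mem_iota; lia.
elim: n u v => [|n IHn] u v.
  rewrite inE; apply/eqP/and3P => [[-> ->] //|[_ _ /perm_size]].
  by rewrite size_cat; case: u v => [|? ?] [|? ?].
have iota1S : iota 1 n.+1 = rcons (iota 1 n) n.+1 by rewrite -[in LHS](addn1 n) iotaD cats1.
have perm_u s t : perm_eq (rcons s n.+1 ++ t) (iota 1 n.+1) = perm_eq (s ++ t) (iota 1 n).
  rewrite -[in RHS](perm_cons n.+1) cat_rcons -[n.+1 :: t]cat1s perm_catCA cat1s.
  by rewrite iota1S perm_sym perm_rcons perm_sym.
have perm_v s t : perm_eq (s ++ rcons t n.+1) (iota 1 n.+1) = perm_eq (s ++ t) (iota 1 n).
  by rewrite perm_catC perm_u perm_catC.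
have lt_splits s t : (s, t) \in splits n -> all (ltn^~ n.+1) s && all (ltn^~ n.+1) t.
  by rewrite IHn -all_cat => /and3P[_ _ /bounded].
rewrite [splits _]/= mem_cat; apply/orP/and3P.
- case=> /mapP[[s t] st [-> ->]]; move: (lt_splits _ _ st) => /= /andP[lts ltt].
    by move: st; rewrite IHn perm_u sorted_ltn_rcons lts andbT => /and3P.
  by move: st; rewrite IHn perm_v sorted_ltn_rcons ltt andbT => /and3P.
- move=> [su sv puv]; have := bounded _ _ puv; rewrite all_cat => /andP[bu bv].
  have: n.+1 \in u ++ v by rewrite (perm_mem puv) mem_iota; lia.
  rewrite mem_cat.
  case/orP=> [/(sorted_max _ _ su bu)[u' def_u su']|/(sorted_max _ _ sv bv)[v' def_v sv']].
    left; apply/mapP; exists (u', v); rewrite ?def_u // IHn su' sv.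
    by rewrite -perm_u -def_u.
  right; apply/mapP; exists (u, v'); rewrite ?def_v // IHn su sv'.
  by rewrite -perm_v -def_v.
Qed.

Lemma size_splits n p : p \in splits n -> size p.1 + size p.2 = n.
Proof.
by case: p => u v; rewrite mem_splits -size_cat => /and3P[_ _ /perm_size->]; rewrite size_iota.
Qed.

Lemma splits_le n p y : p \in splits n -> y \in p.1 ++ p.2 -> 0 < y <= n.
Proof.
case: p => u v; rewrite mem_splits => /and3P[_ _ /perm_mem->]; rewrite mem_iota; lia.
Qed.

Lemma uniq_splits n : uniq (splits n).
Proof.
elim: n => //= n IHn; rewrite cat_uniq.
have inj_u : injective (fun p : seq nat * seq nat => (rcons p.1 n.+1, p.2)).
  by move=> [u v] [u' v'] /= [/(@rcons_injl _ n.+1)-> ->].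
have inj_v : injective (fun p : seq nat * seq nat => (p.1, rcons p.2 n.+1)).
  by move=> [u v] [u' v'] /= [-> /(@rcons_injl _ n.+1)->].
rewrite (map_inj_uniq inj_u) (map_inj_uniq inj_v) IHn andbT /=.
apply/hasPn=> _ /mapP[p pS ->]; apply/negP=> /mapP[q _ [def_u _]].
have := @splits_le _ _ n.+1 pS; rewrite def_u mem_cat mem_rcons inE eqxx /=; lia.
Qed.

Lemma perm_interlace u v : perm_eq (interlace u v) (u ++ v).
Proof.
elim: u v => [|a u IHu] [|b v] //=; first by rewrite cats0.
by rewrite perm_cons perm_sym -[b :: v]cat1s perm_catCA cat1s perm_cons perm_sym.
Qed.

(** Interlacing loses the pair of words in general: the sizes have to be known. *)
Lemma interlace_inj u v u' v' : size u = size u' -> size v = size v' ->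
  interlace u v = interlace u' v' -> (u, v) = (u', v').
Proof.
elim: u v u' v' => [|a u IHu] [|b v] [|a' u'] [|b' v'] //=; last first.
  by move=> [su] [sv] [-> -> /IHu-/(_ su sv)[-> ->]].
- by move=> _ _ ->.
- by move=> _ _ ->.
Qed.

Lemma eq_uphalf {a b n} : a + b = n -> (b <= a <= b.+1) = (a == uphalf n).
Proof. lia. Qed.

(** The size condition on the two words only depends on the length of the
    permutation, so a faro permutation is a split whose first word has
    [uphalf n] letters. *)
Lemma perm_faro_perms n :
  perm_eq (faro_perms n)
    [seq interlace p.1 p.2 | p <- splits n & size p.1 == uphalf n].
Proof.
apply: uniq_perm.
- by rewrite filter_uniq ?permutations_uniq.
- rewrite map_inj_in_uniq ?filter_uniq ?uniq_splits // => -[u v] [u' v'].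
  rewrite !mem_filter /= => /andP[/eqP su /size_splits /= suv].
  move=> /andP[/eqP su' /size_splits /= suv'].
  by apply: interlace_inj; lia.
move=> w; rewrite mem_filter mem_permutations; apply/andP/mapP.
  move=> [/asboolP[u [v [su sv suv ->]]] pw]; exists (u, v) => //.
  have puv : perm_eq (u ++ v) (iota 1 n).
    by apply: perm_trans pw; rewrite perm_sym perm_interlace.
  rewrite mem_filter mem_splits su sv puv /=.
  have sz : size u + size v = n by rewrite -size_cat (perm_size puv) size_iota.
  by rewrite andbT -(eq_uphalf sz).
move=> [[u v]]; rewrite mem_filter mem_splits /= => /andP[/eqP sz /and3P[su sv puv]] ->.
split; last by rewrite (perm_trans (perm_interlace u v)).
apply/asboolP; exists u, v; split=> //.
have sz' : size u + size v = n by rewrite -size_cat (perm_size puv) size_iota.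
by rewrite (eq_uphalf sz') sz.
Qed.

Lemma popularityE p n : popularity p n =
  \sum_(q <- splits n | size q.1 == uphalf n) occurrences p (interlace q.1 q.2).
Proof.
by rewrite /popularity (perm_big _ (perm_faro_perms n)) big_map big_filter.
Qed.

Lemma sum_splitsS n (P : pred (seq nat * seq nat)) (F : seq nat * seq nat -> nat) :
  \sum_(p <- splits n.+1 | P p) F p =
    \sum_(p <- splits n | P (rcons p.1 n.+1, p.2)) F (rcons p.1 n.+1, p.2)
    + \sum_(p <- splits n | P (p.1, rcons p.2 n.+1)) F (p.1, rcons p.2 n.+1).
Proof. by rewrite big_cat !big_map. Qed.

(** A split is the choice of the letters of its first word; Pascal's rule is the
    removal of the maximum. *)
Lemma card_splits n a : \sum_(p <- splits n | size p.1 == a) 1 = 'C(n, a).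
Proof.
elim: n a => [|n IHn] a; first by rewrite unlock; case: a.
rewrite sum_splitsS /=; under eq_bigl do rewrite size_rcons.
case: a => [|a]; last by rewrite !IHn addnC binS.
by rewrite big_pred0 // IHn !bin0.
Qed.

Lemma interlace_rconsl u v x :
  size u = size v -> interlace (rcons u x) v = rcons (interlace u v) x.
Proof. by elim: u v => [|a u IHu] [|b v] //= [/IHu->]. Qed.

Lemma interlace_rconsr u v y :
  size u = (size v).+1 -> interlace u (rcons v y) = rcons (interlace u v) y.
Proof. by elim: u v => [|a u IHu] [|b v] //= [su]; [case: u su {IHu}|rewrite IHu]. Qed.

(** * Patterns in words with increasing letters at distance two *)

Fixpoint skip_sorted (w : seq nat) : bool :=
  if w is a :: (_ :: c :: _) as w' then (a < c) && skip_sorted w' else true.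

Definition descents (w : seq nat) := count (fun p => p.2 < p.1) (zip w (behead w)).

Lemma occurrences_cons p x w :
  occurrences p (x :: w) = order_iso (take (size p) (x :: w)) p + occurrences p w.
Proof.
have shift : iota 0 (size (x :: w)).+1 = 0 :: map (addn 1) (iota 0 (size w).+1).
  by rewrite -iotaDl.
by rewrite /occurrences shift [LHS]/= count_map.
Qed.

Lemma order_iso2 a b a' b' : order_iso [:: a; b] [:: a'; b'] =
  ((a < b) == (a' < b')) && ((b < a) == (b' < a')).
Proof. by rewrite /order_iso /= !ltnn !eqxx /= !andbT. Qed.

Lemma order_iso3 a b c a' b' c' : order_iso [:: a; b; c] [:: a'; b'; c'] =
  [&& (a < b) == (a' < b'), (b < a) == (b' < a'), (a < c) == (a' < c'),
      (c < a) == (c' < a'), (b < c) == (b' < c') & (c < b) == (c' < b')].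
Proof. rewrite /order_iso /= !ltnn !eqxx /= !andbT. by do !case: eqP. Qed.

Lemma descents_cons a b w : descents [:: a, b & w] = (b < a) + descents (b :: w).
Proof. by []. Qed.

Lemma occurrences21 w : occurrences [:: 2; 1] w = descents w.
Proof.
elim: w => [|a [|b w] IHw] //; rewrite occurrences_cons IHw [take _ _]/= take0.
by rewrite order_iso2 descents_cons; case: ltngtP.
Qed.

Lemma occurrences12 w : uniq w -> occurrences [:: 1; 2] w + descents w = (size w).-1.
Proof.
elim: w => [|a [|b w] IHw] // /andP[]; rewrite inE negb_or => /andP[neq_ab _] /IHw.
rewrite (occurrences_cons _ a) descents_cons [take _ _]/= take0 order_iso2 /=.
by case: ltngtP neq_ab => //= _ _; lia.
Qed.

(** When [a < c], the factor [a b c] is a [132] as soon as [c < b]; hence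
    every descent is the end of a [132], except one at the first position. *)
Lemma occurrences132 w : skip_sorted w -> occurrences [:: 1; 3; 2] w = descents (behead w).
Proof.
elim: w => [|a [|b [|c w]] IHw] // /andP[lt_ac /IHw]; rewrite (occurrences_cons _ a) => ->.
rewrite [behead _]/= descents_cons [take _ _]/= take0 order_iso3 /=.
by congr (_ + _); lia.
Qed.

(** Symmetrically, when [a < c], the factor [a b c] is a [213] as soon as
    [b < a], so only a descent at the last position is lost. *)
Lemma occurrences213 w x : skip_sorted (rcons w x) ->
  occurrences [:: 2; 1; 3] (rcons w x) = descents w.
Proof.
elim: w => [|a [|b w] IHw] // sw.
have [c [t def_t]] : exists c t, rcons w x = c :: t.
  by case: (w) => [|c t]; [exists x, [::]|exists c, (rcons t x)].
move: sw IHw; rewrite !rcons_cons def_t => /andP[lt_ac s_bct] /(_ s_bct) IHw.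
rewrite occurrences_cons IHw descents_cons [take _ _]/= take0 order_iso3 /=.
by congr (_ + _); lia.
Qed.

(** No other pattern of length 3 is compatible with [a < c]. *)
Lemma occurrences123 w : uniq w -> skip_sorted w ->
  occurrences [:: 1; 2; 3] w + occurrences [:: 1; 3; 2] w + occurrences [:: 2; 1; 3] w
    = (size w).-2.
Proof.
elim: w => [|a [|b [|c w]] IHw] // /andP[a_notin ub] /andP[lt_ac /(IHw ub)].
have /andP[b_notin _] := ub; move: a_notin b_notin.
rewrite !inE !negb_or => /and3P[neq_ab _ _] /andP[neq_bc _].
rewrite !(occurrences_cons _ a) ![take _ [:: a, b, c & w]]/= take0 !order_iso3 /=.
lia.
Qed.

Lemma interlace_consl c u v : exists t, interlace (c :: u) v = c :: t.
Proof. by case: v => [|b v]; [exists u|exists (b :: interlace u v)]. Qed.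

Lemma skip_sorted_interlace u v :
  sorted ltn u -> sorted ltn v -> size v <= size u <= (size v).+1 ->
  skip_sorted (interlace u v).
Proof.
elim: u v => [|a [|c u] IHu] [|b [|d v]] //= su sv suv.
- by case/andP: su => -> _; case: u {IHu} suv.
- case/andP: su sv => -> su /andP[lt_bd sv]; rewrite /= lt_bd.
  by apply: (IHu (d :: v)).
Qed.

(** * The total number of descents *)

(** The descents of [interlace u v], in a form that makes sense for words of
    arbitrary sizes because [zip] truncates: the descents from [u_i] to [v_i],
    then those from [v_i] to [u_(i+1)]. *)
Definition pair_descents (u v : seq nat) :=
  count (fun p => p.2 < p.1) (zip u v) + count (fun p => p.1 < p.2) (zip (behead u) v).

Lemma descents_interlace u v : size v <= size u <= (size v).+1 ->
  descents (interlace u v) = pair_descents u v.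
Proof.
elim: u v => [|a [|c u] IHu] [|b v] //=.
  by case: v => // _; rewrite /pair_descents /= addn0.
move=> /(IHu v); have [t def_t] := interlace_consl c u v.
rewrite -[match v with [::] => _ | _ => _ end]/(interlace (c :: u) v) def_t.
by rewrite !descents_cons => ->; rewrite /pair_descents /=; lia.
Qed.

Lemma count_zip_rconsl (P : pred (nat * nat)) u v x :
  count P (zip (rcons u x) v) =
  count P (zip u v) + (size u < size v) && P (x, nth 0 v (size u)).
Proof.
elim: u v => [|a u IHu] [|b v] //=; last by rewrite IHu ltnS addnA.
by case: v => [|? ?] /=; rewrite addn0.
Qed.

Lemma count_zip_rconsr (P : pred (nat * nat)) u v x :
  count P (zip u (rcons v x)) =
  count P (zip u v) + (size v < size u) && P (nth 0 u (size v), x).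
Proof.
elim: u v => [|a u IHu] [|b v] //=; last by rewrite IHu ltnS addnA.
by case: u {IHu} => [|? ?] /=; rewrite addn0.
Qed.

(** A new maximum [x] in [u] is compared with the letter of [v] at the same index,
    if there is one, which yields a descent, and with the preceding letter of [v],
    which does not. *)
Lemma pair_descents_rconsl u v x : all (ltn^~ x) v ->
  pair_descents (rcons u x) v = pair_descents u v + (size u < size v).
Proof.
move=> /(all_nthP 0)/= lt_vx; rewrite /pair_descents.
have -> : count (fun p => p.1 < p.2) (zip (behead (rcons u x)) v)
          = count (fun p => p.1 < p.2) (zip (behead u) v).
  case: u => [|a u] //=.
  rewrite count_zip_rconsl /=; case: (ltnP (size u) (size v)) => [/lt_vx|_] /=; lia.
rewrite count_zip_rconsl /= addnAC.
by case: (ltnP (size u) (size v)) => //= /lt_vx->.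
Qed.

Lemma pair_descents_rconsr u v x : all (ltn^~ x) u ->
  pair_descents u (rcons v x) = pair_descents u v + ((size v).+1 < size u).
Proof.
move=> /(all_nthP 0)/= lt_ux; rewrite /pair_descents !count_zip_rconsr /=.
rewrite nth_behead size_behead ltn_predRL.
by case: (ltnP (size v) (size u)) => [/lt_ux|];
  case: (ltnP (size v).+1 (size u)) => [/lt_ux|] /=; lia.
Qed.

Definition descent_total n a := \sum_(p <- splits n | size p.1 == a) pair_descents p.1 p.2.

Lemma all_lt_splits n p : p \in splits n -> all (ltn^~ n.+1) p.1 && all (ltn^~ n.+1) p.2.
Proof.
by move=> pS; rewrite -all_cat; apply/allP=> y /(splits_le _ _ _ pS) /andP[].
Qed.

Lemma eq_sum_splits n a (F G : seq nat -> seq nat -> nat) :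
  (forall u v : seq nat, size u = a -> size u + size v = n ->
     all (ltn^~ n.+1) u -> all (ltn^~ n.+1) v -> (u, v) \in splits n -> F u v = G u v) ->
  \sum_(p <- splits n | size p.1 == a) F p.1 p.2
    = \sum_(p <- splits n | size p.1 == a) G p.1 p.2.
Proof.
move=> eqFG; rewrite big_seq_cond [RHS]big_seq_cond.
apply: eq_bigr => -[u v] /andP[pS /eqP sz]; have /andP[lt_u lt_v] := all_lt_splits _ _ pS.
exact: eqFG (size_splits _ _ pS) _ _ _.
Qed.

(** Read a split as a lattice path, with an up step for each letter of the first
    word: the descents are the up steps that end at height at most 0 and the down
    steps that start at height at least 2. *)
Lemma descent_totalS n a : descent_total n.+1 a.+1 =
  descent_total n a + (a < n - a) * 'C(n, a)
  + (descent_total n a.+1 + (n - a < a.+1) * 'C(n, a.+1)).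
Proof.
rewrite /descent_total sum_splitsS -!card_splits !big_distrr -!big_split /=.
under eq_bigl do rewrite size_rcons.
congr (_ + _).
  apply: (@eq_sum_splits _ _ (fun u v => pair_descents (rcons u n.+1) v)
            (fun u v => pair_descents u v + (a < n - a) * 1)) => u v sz_u sz_v _ lt_v _.
  by rewrite pair_descents_rconsl //; lia.
apply: (@eq_sum_splits _ _ (fun u v => pair_descents u (rcons v n.+1))
          (fun u v => pair_descents u v + (n - a < a.+1) * 1)) => u v sz_u sz_v lt_u _ _.
by rewrite pair_descents_rconsr //; lia.
Qed.

Lemma descent_total0 n : descent_total n 0 = 0.
Proof.
rewrite /descent_total big1_seq // => -[[|a u] [|b v]] //=.
Qed.

Lemma sum_binS n m :
  \sum_(j < m.+1) 'C(n.+1, j) = \sum_(j < m.+1) 'C(n, j) + \sum_(j < m) 'C(n, j).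
Proof.
rewrite big_ord_recl [in RHS]big_ord_recl !bin0 -addnA -big_split.
by congr (_ + _); apply: eq_bigr => i _; rewrite binS.
Qed.

(** In terms of paths from 0 to a height [h >= 0], the case [h < 0] being
    symmetric: up and down steps below level 0 are equally many, so the descents
    are as many as the down steps that do not go from level 1 to level 0.  By
    reflection, the excluded ones are as many, over all paths, as the paths that
    end above [h], hence the sum of binomials.  The proof checks the formula on
    the recurrence, where exactly one of the two conditions on the last step
    holds. *)
Lemma descent_totalE n a :
  descent_total n a + \sum_(j < minn a (n - a)) 'C(n, j) = minn a (n - a) * 'C(n, a).
Proof.
elim: n a => [|n IHn] [|a]; rewrite ?min0n ?descent_total0 ?big_ord0 //.
  by rewrite sub0n minn0 /descent_total unlock.
have [lt_a_n | le_n_a] := ltnP a (n - a).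
  have := IHn a; have := IHn a.+1; rewrite descent_totalS lt_a_n.
  have -> : minn a (n - a) = a by lia.
  have -> : minn a.+1 (n.+1 - a.+1) = a.+1 by lia.
  have -> : (n - a < a.+1) = false by lia.
  rewrite sum_binS binS mul1n mul0n.
  have [lt_aS_n|] := ltnP a.+1 (n - a).
    have -> : minn a.+1 (n - a.+1) = a.+1 by lia.
    nia.
  (* Here [n = 2 * a + 1]: the minimum stays equal to [a], and the missing term is
     supplied by the equality of the two middle binomials. *)
  move=> le_n_aS; have -> : minn a.+1 (n - a.+1) = a by lia.
  have -> : 'C(n, a.+1) = 'C(n, a) by rewrite -bin_sub; [congr 'C(_, _)|]; lia.
  rewrite big_ord_recr /=; nia.
have := IHn a; have := IHn a.+1; rewrite descent_totalS.
have -> : (a < n - a) = false by lia.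
case def_b : (n - a) => [|b].
  have -> : n - a.+1 = 0 by lia.
  rewrite subSS def_b !minn0 !big_ord0; have -> : 'C(n, a.+1) = 0 by rewrite bin_small //; lia.
  lia.
have -> : minn a b.+1 = b.+1 by lia.
have -> : minn a.+1 (n - a.+1) = b by lia.
have -> : minn a.+1 (n.+1 - a.+1) = b.+1 by lia.
have -> : (b.+1 < a.+1) by lia.
rewrite sum_binS binS; nia.
Qed.

(** Half of the binomial theorem: the two halves of row [n] are equal, and the
    middle is one entry or two equal ones according to the parity of [n]. *)
Lemma sum_bin_half n :
  2 * (\sum_(j < n./2) 'C(n, j)) + (odd n).+1 * 'C(n, n./2) = 2 ^ n.
Proof.
elim: n => [|n IHn]; first by rewrite big_ord0.
have := sum_binS n n./2; rewrite [in X in _ = X + _]big_ord_recr /= expnS -IHn.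
case: (boolP (odd n)) => odd_n.
  have -> : uphalf n = n./2.+1 by lia.
  have := binS n n./2.
  have -> : 'C(n, n./2.+1) = 'C(n, n./2) by rewrite -bin_sub; [congr 'C(_, _)|]; lia.
  rewrite /=; lia.
have -> : uphalf n = n./2 by lia.
rewrite big_ord_recr /=; lia.
Qed.

Lemma bin_uphalf n : 'C(n, uphalf n) = 'C(n, n./2).
Proof. by rewrite -bin_sub; [congr 'C(_, _)|]; lia. Qed.

Lemma card_faro n : \sum_(p <- splits n | size p.1 == uphalf n) 1 = 'C(n, n./2).
Proof. by rewrite card_splits bin_uphalf. Qed.

Lemma splits_interlace {n u v} : (u, v) \in splits n -> size u = uphalf n ->
  [/\ uniq (interlace u v), skip_sorted (interlace u v), size (interlace u v) = n
    & size v <= size u <= (size v).+1].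
Proof.
move=> uvS sz_u; have sz := size_splits _ _ uvS.
have suv : size v <= size u <= (size v).+1 by rewrite (eq_uphalf sz) sz_u.
move: uvS; rewrite mem_splits => /and3P[su sv puv].
have pw := perm_trans (perm_interlace u v) puv; split=> //.
- by rewrite (perm_uniq pw) iota_uniq.
- exact: skip_sorted_interlace.
- by rewrite (perm_size pw) size_iota.
Qed.

Lemma popularity21 n : popularity [:: 2; 1] n = descent_total n (uphalf n).
Proof.
rewrite popularityE; apply: (@eq_sum_splits _ _ (fun u v => occurrences _ (interlace u v))).
move=> u v sz_u _ _ _ /splits_interlace /(_ sz_u)[_ _ _ suv].
by rewrite occurrences21 descents_interlace.
Qed.

Lemma popularity21_closed n :
  2 * popularity [:: 2; 1] n + 2 ^ n = n.+1 * 'C(n, n./2).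
Proof.
have := descent_totalE n (uphalf n); rewrite -popularity21 bin_uphalf.
have -> : minn (uphalf n) (n - uphalf n) = n./2 by lia.
have -> : n.+1 = 2 * n./2 + (odd n).+1 by lia.
by rewrite -sum_bin_half mulnDl -mulnA => <-; lia.
Qed.

(** * The other patterns in terms of descents *)

Lemma popularity12 n :
  popularity [:: 1; 2] n + popularity [:: 2; 1] n = n.-1 * 'C(n, n./2).
Proof.
rewrite !popularityE -card_faro big_distrr -big_split.
apply: (@eq_sum_splits _ _ (fun u v => occurrences [:: 1; 2] (interlace u v)
                            + occurrences [:: 2; 1] (interlace u v)) (fun _ _ => n.-1 * 1)).
move=> u v sz_u _ _ _ /splits_interlace /(_ sz_u)[uw _ sz_w _].
by rewrite occurrences21 occurrences12 // sz_w muln1.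
Qed.

Lemma popularity123 n :
  popularity [:: 1; 2; 3] n + popularity [:: 1; 3; 2] n + popularity [:: 2; 1; 3] n
    = n.-2 * 'C(n, n./2).
Proof.
rewrite !popularityE -card_faro big_distrr -!big_split.
apply: (@eq_sum_splits _ _ (fun u v => occurrences [:: 1; 2; 3] (interlace u v)
                            + occurrences [:: 1; 3; 2] (interlace u v)
                            + occurrences [:: 2; 1; 3] (interlace u v)) (fun _ _ => n.-2 * 1)).
move=> u v sz_u _ _ _ /splits_interlace /(_ sz_u)[uw sw sz_w _].
by rewrite occurrences123 // sz_w muln1.
Qed.

Lemma count_min_first n a :
  \sum_(p <- splits n.+1 | size p.1 == a.+1) (1 \in p.1) = 'C(n, a).
Proof.
elim: n a => [|n IHn] a; first by rewrite unlock; case: a.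
rewrite sum_splitsS /=; under eq_bigl do rewrite size_rcons.
under eq_bigr do rewrite mem_rcons inE /=.
rewrite IHn; case: a => [|a]; last by rewrite IHn addnC binS.
by rewrite big1 ?bin0 // => -[[|? ?] ?].
Qed.

Lemma count_max_first n a :
  \sum_(p <- splits n.+1 | size p.1 == a.+1) (n.+1 \in p.1) = 'C(n, a).
Proof.
rewrite sum_splitsS /=; under eq_bigl do rewrite size_rcons.
under eq_bigr do rewrite mem_rcons inE eqxx /=.
rewrite card_splits big1_seq ?addn0 // => p /andP[_ pS].
by apply/eqP; rewrite eqb0; apply/negP=> /(allP (proj1 (andP (all_lt_splits _ _ pS)))) /=; lia.
Qed.

Lemma count_max_second n a :
  \sum_(p <- splits n.+1 | size p.1 == a) (n.+1 \in p.2) = 'C(n, a).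
Proof.
rewrite sum_splitsS /=; under [X in _ + X = _]eq_bigr do rewrite mem_rcons inE eqxx /=.
rewrite card_splits big1_seq // => p /andP[_ pS].
by apply/eqP; rewrite eqb0; apply/negP=> /(allP (proj2 (andP (all_lt_splits _ _ pS)))) /=; lia.
Qed.

(** One of the first two letters of a faro permutation is 1. *)
Lemma head_descent {n a u b v} : (a :: u, b :: v) \in splits n ->
  (b < a) + (1 \in a :: u) = 1.
Proof.
move=> uvS; have ge1 y := splits_le _ _ y uvS.
have mem1 : 1 \in (a :: u) ++ (b :: v).
  move: uvS; rewrite mem_splits => /and3P[_ _ puv].
  by rewrite (perm_mem puv) mem_iota; have := perm_size puv; rewrite size_iota /=; lia.
have min_head x s : sorted ltn (x :: s) -> 1 \in x :: s -> x <= 1.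
  by rewrite /= (path_sortedE ltn_trans) inE => /andP[/allP gt_x _] /predU1P[<-|/gt_x /=]; lia.
have a_gt0 : 0 < a by have := ge1 a; rewrite inE eqxx => /(_ isT)/andP[].
have b_gt0 : 0 < b by have := ge1 b; rewrite mem_cat !inE eqxx !orbT => /(_ isT)/andP[].
move: uvS mem1; rewrite mem_splits mem_cat => /and3P[/min_head min_a /min_head min_b _].
case: (boolP (1 \in a :: u)) => [/min_a|nmem_a /= /min_b le_b1]; first by lia.
suff : a != 1 by lia.
by apply: contra nmem_a => /eqP<-; rewrite inE eqxx.
Qed.

Lemma popularity132 n :
  popularity [:: 1; 3; 2] n.+1 + 'C(n.+1, n.+1./2)
    = popularity [:: 2; 1] n.+1 + 'C(n, n./2).
Proof.
rewrite -[X in _ + X]card_faro -[X in _ = _ + X]count_min_first !popularityE -!big_split.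
apply: (@eq_sum_splits _ _ (fun u v => occurrences [:: 1; 3; 2] (interlace u v) + 1)
   (fun u v => occurrences [:: 2; 1] (interlace u v) + (1 \in u))).
move=> u v sz_u sz _ _ uvS; have [_ sw _ _] := splits_interlace uvS sz_u.
rewrite occurrences132 // occurrences21.
case: u v sz_u sz uvS {sw} => [|a u] // [|b v] sz_u sz uvS.
  case: u sz_u sz uvS => [|? ?] /= sz_u sz; last by lia.
  have -> : n = 0 by lia.
  by rewrite !inE => /orP[|] // /eqP[->].
rewrite [interlace _ _]/= descents_cons [behead _]/=.
by rewrite addnAC (head_descent uvS) addnC.
Qed.

(** The maximum is the last letter of [rcons s y] or of [t]; here [y] is the last
    letter of the permutation and [t] the word that contains the letter before. *)
Lemma last_descent {n s y t} : sorted ltn (rcons s y) -> sorted ltn t ->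
  perm_eq (rcons s y ++ t) (iota 1 n.+1) ->
  (y < last 0 t) + (n.+1 \in rcons s y) = 1.
Proof.
move=> ss st pst.
have le_n z : z \in rcons s y ++ t -> z <= n.+1.
  by rewrite (perm_mem pst) mem_iota => /andP[].
have [le_s le_t] : all (leq^~ n.+1) (rcons s y) /\ all (leq^~ n.+1) t.
  by split; apply/allP=> z zst; apply: le_n; rewrite mem_cat zst ?orbT.
have : n.+1 \in rcons s y ++ t by rewrite (perm_mem pst) mem_iota /=; lia.
rewrite mem_cat; case: (boolP (n.+1 \in rcons s y)) => /= [/(sorted_max _ _ ss le_s)|nmem_s].
  case=> s' /rcons_inj[_ ->] _ _.
  have : last 0 t <= n.+1; last by lia.
  by case: (lastP t) le_t => //= t' z; rewrite all_rcons last_rcons => /andP[].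
move=> /(sorted_max _ _ st le_t)[t' -> _]; rewrite last_rcons.
have : y <= n.+1 by apply: le_n; rewrite mem_cat mem_rcons inE eqxx.
suff : y != n.+1 by lia.
by apply: contra nmem_s => /eqP<-; rewrite mem_rcons inE eqxx.
Qed.

Lemma descents_rcons w y : descents (rcons w y) = descents w + (y < last 0 w).
Proof.
elim: w => [|a [|b w] IHw] //; first by rewrite /descents /= addn0.
by rewrite !rcons_cons !descents_cons -rcons_cons IHw addnA.
Qed.

Lemma last_interlace_eq x u v :
  size u = size v -> last x (interlace u v) = last x v.
Proof. by elim: u v x => [|a u IHu] [|b v] x //= [/IHu]. Qed.

Lemma last_interlace_succ x u v :
  size u = (size v).+1 -> last x (interlace u v) = last x u.
Proof.
elim: u v x => [|a u IHu] [|b v] x //= [su].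
by rewrite IHu //; case: u su {IHu}.
Qed.

(** The last letter belongs to [u] or to [v] according to the parity of the
    length; either way, ['C(n, n./2)] faro permutations end with their maximum. *)
Lemma popularity213 n :
  popularity [:: 2; 1; 3] n.+1 + 'C(n.+1, n.+1./2)
    = popularity [:: 2; 1] n.+1 + 'C(n, n./2).
Proof.
have count_max : \sum_(p <- splits n.+1 | size p.1 == uphalf n.+1)
    (n.+1 \in (if odd n then p.2 else p.1)) = 'C(n, n./2).
  case: (boolP (odd n)) => odd_n; last by rewrite count_max_first.
  by rewrite count_max_second -bin_uphalf; congr 'C(_, _); lia.
rewrite -[X in _ + X]card_faro -[X in _ = _ + X]count_max !popularityE -!big_split.
apply: (@eq_sum_splits _ _ (fun u v => occurrences [:: 2; 1; 3] (interlace u v) + 1)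
   (fun u v => occurrences [:: 2; 1] (interlace u v) + (n.+1 \in if odd n then v else u))).
move=> u v sz_u sz _ _ uvS; have [_ sw _ _] := splits_interlace uvS sz_u.
move: uvS; rewrite occurrences21 mem_splits => /and3P[su sv puv].
have [w [y [def_w eq1]]] : exists w y, interlace u v = rcons w y /\
    (y < last 0 w) + (n.+1 \in if odd n then v else u) = 1.
  case: (boolP (odd n)) => odd_n.
    case/lastP: v sz sv puv {sw} => [|v y] sz sv puv; first by move: sz => /=; lia.
    have sz_uv : size u = (size v).+1 by move: sz; rewrite size_rcons; lia.
    exists (interlace u v), y; rewrite interlace_rconsr // last_interlace_succ //.
    by split=> //; apply: last_descent sv su _; rewrite perm_catC.
  case/lastP: u sz_u sz su puv {sw} => [|u y] sz_u sz su puv; first by move: sz_u => /=; lia.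
  have sz_uv : size u = size v by move: sz sz_u; rewrite size_rcons; lia.
  exists (interlace u v), y; rewrite interlace_rconsl // last_interlace_eq //.
  by split=> //; apply: last_descent su sv _.
rewrite def_w in sw *; rewrite occurrences213 // descents_rcons.
by rewrite -addnA eq1.
Qed.

Lemma central_binS_odd n : odd n -> 'C(n.+1, n.+1./2) = 2 * 'C(n, n./2).
Proof.
move=> odd_n; have -> : n.+1./2 = n./2.+1 by lia.
rewrite binS.
have -> : 'C(n, n./2.+1) = 'C(n, n./2) by rewrite -bin_uphalf; congr 'C(_, _); lia.
by rewrite mul2n addnn.
Qed.

Lemma central_binS_even n : ~~ odd n -> n./2.+1 * 'C(n.+1, n.+1./2) = n.+1 * 'C(n, n./2).
Proof.
move=> even_n; rewrite (mul_bin_down n.+1) /=; have -> : uphalf n = n./2 by lia.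
by congr (_ * _); lia.
Qed.

(** Together with [popularity21_closed], this eliminates the factor [n.+1], which
    would be a derivative on generating functions. *)
Lemma central_bin_rec n :
  n.+3 * 'C(n.+2, n.+2./2) = 4 * (n.+1 * 'C(n, n./2)) + 2 * 'C(n.+1, n.+1./2).
Proof.
case: (boolP (odd n)) => odd_n.
  have := @central_binS_even n.+1; have := central_binS_odd _ odd_n.
  rewrite [odd _]/= odd_n; have -> : n.+1./2 = n./2.+1 by lia.
  move=> -> /(_ isT) H; have n_eq : n = n./2.*2.+1 by lia.
  have -> : n.+3 = 2 * n./2.+2 by lia.
  by rewrite -mulnA H; lia.
have := @central_binS_odd n.+1; have := central_binS_even _ odd_n.
rewrite [odd _]/= odd_n => <- /(_ isT)->.
have -> : n.+3 = 2 * n./2.+1 + 1 by lia.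
by lia.
Qed.

Lemma popularity21SS n :
  popularity [:: 2; 1] n.+2 = 4 * popularity [:: 2; 1] n + 'C(n.+1, n.+1./2).
Proof.
have := popularity21_closed n.+2; have := popularity21_closed n; rewrite central_bin_rec => <-.
rewrite !expnS; lia.
Qed.

Lemma popularity21_lt2 n : n < 2 -> popularity [:: 2; 1] n = 0.
Proof. by have := popularity21_closed n; case: n => [|[]] //=; rewrite ?bin0; lia. Qed.

Local Open Scope ring_scope.

(** * Coefficients of products by X and by integers *)

Section Coefficients.
Variable K : fieldType.
Implicit Types f g : fps K.

Lemma fcoefXM f n : fcoef (fpsX * f) n = if n is m.+1 then fcoef f m else 0.
Proof.
rewrite fcoefM; case: n => [|n]; first by rewrite big_ord1 mul0r.
rewrite big_ord_recl mul0r add0r big_ord_recl mul1r big1 ?addr0 ?subn1 //.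
by move=> i _; rewrite mul0r.
Qed.

Lemma fcoefMn f k n : fcoef (f *+ k) n = fcoef f n *+ k.
Proof. by elim: k => [|k IHk]; rewrite ?mulr0n // !mulrS fcoefD IHk. Qed.

Lemma fcoefB f g n : fcoef (f - g) n = fcoef f n - fcoef g n.
Proof. by []. Qed.
End Coefficients.

(** * The generating function of central binomial coefficients *)

Section GeneratingFunctions.

Local Notation x := (fpsX : fps rat).

Definition radical : fps rat := fps_sqrt (1 - 4 * x ^+ 2).
Local Notation r := radical.

(** The series [x C(x^2)], with [C] the Catalan series, of the walks with steps
    1 and -1 that first reach level 1 at their end.  This form avoids a division
    by [x]. *)
Definition climb_gf : fps rat := 2 * x / (1 + r).
Local Notation z := climb_gf.

Lemma sqr_radical : r ^+ 2 = 1 - 4 * x ^+ 2.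
Proof.
rewrite /radical sqr_fps_sqrt // mulr_natl fcoefB fcoefMn expr2 fcoefXM.
by rewrite mul0rn subr0.
Qed.

Lemma unit_radical : r \is a GRing.unit.
Proof. by rewrite fps_unitE. Qed.

Lemma unit_1D_radical : 1 + r \is a GRing.unit.
Proof. by rewrite fps_unitE. Qed.

Lemma unit_1B_2x : 1 - 2 * x \is a GRing.unit.
Proof. by rewrite fps_unitE fcoefB mulr_natl fcoefMn. Qed.

Lemma climb_gfE : z * (1 + r) = 2 * x.
Proof. by rewrite /climb_gf mulrVK ?unit_1D_radical. Qed.

Lemma mulx_climb_gf : 2 * x * z = 1 - r.
Proof.
apply: (mulIr unit_1D_radical); rewrite -[LHS]mulrA climb_gfE.
have -> : (1 - r) * (1 + r) = 1 - r ^+ 2 by ring.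
by rewrite sqr_radical; ring.
Qed.

Lemma climb_gf_quad : z = x * (1 + z ^+ 2).
Proof.
apply: (mulIr unit_1D_radical); apply: (mulIr unit_1D_radical).
have -> : x * (1 + z ^+ 2) * (1 + r) * (1 + r) =
    x * ((1 + r) ^+ 2 + (z * (1 + r)) ^+ 2) by ring.
have -> : (1 + r) ^+ 2 = 1 + 2 * r + r ^+ 2 by ring.
by rewrite climb_gfE sqr_radical; ring.
Qed.

(** The walks with steps 1 and -1 from 0 that end at [h] or [h + 1]: adding two
    consecutive levels puts both parities of the length in one series. *)
Definition walk_gf h := z ^+ h * (1 + z) / r.

(** A walk reaches level 0 or 1 by a last step from -1 or 0, or from 1 or 2, and the
    former two levels are as good as 0 and 1 by symmetry. *)
Lemma walk_gf0 : walk_gf 0 = 1 + x * (walk_gf 0 + walk_gf 1).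
Proof.
apply: (mulIr unit_radical); rewrite /walk_gf.
have -> : (1 + x * (z ^+ 0 * (1 + z) / r + z ^+ 1 * (1 + z) / r)) * r
   = r + x * (z ^+ 0 * (1 + z) / r * r + z ^+ 1 * (1 + z) / r * r) by ring.
rewrite !mulrVK ?unit_radical //.
have -> : r + x * (z ^+ 0 * (1 + z) + z ^+ 1 * (1 + z))
   = r + x * (1 + z ^+ 2) + 2 * x * z by ring.
by rewrite -climb_gf_quad mulx_climb_gf; ring.
Qed.

Lemma walk_gfS h : walk_gf h.+1 = x * (walk_gf h + walk_gf h.+2).
Proof.
rewrite /walk_gf -mulrDl mulrA; congr (_ / r).
rewrite exprS {1}climb_gf_quad !exprS; ring.
Qed.

(** The recurrences [walk_gf0] and [walk_gfS] determine all the coefficients by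
    induction on [n]; on binomials they are Pascal's rule. *)
Lemma coef_walk_gf n h : fcoef (walk_gf h) n = 'C(n, uphalf (n + h))%:R.
Proof.
elim: n h => [|n IHn] [|h].
- by rewrite walk_gf0 fcoefD fcoefXM.
- by rewrite walk_gfS fcoefXM.
- rewrite walk_gf0 fcoefD fcoefXM fcoefD !IHn fcoef1 add0r -natrD.
  rewrite addn1 !addn0 (bin_uphalf n) addnC.
  by rewrite -[uphalf n.+1]/(n./2.+1) -binS.
rewrite walk_gfS fcoefXM fcoefD !IHn -natrD addnC.
have -> : uphalf (n + h.+2) = (uphalf (n + h)).+1 by lia.
by rewrite -binS; congr ('C(_, _)%:R); lia.
Qed.

Definition faro_gf : fps rat := Fps (fun n => 'C(n, n./2)%:R).

Lemma faro_gfE : faro_gf = (1 + z) / r.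
Proof.
transitivity (walk_gf 0); last by rewrite /walk_gf mul1r.
by apply: fpsP => n; rewrite coef_walk_gf addn0 bin_uphalf.
Qed.

Lemma faro_gf_eq : (1 - 2 * x) * faro_gf = 1 - z.
Proof.
rewrite faro_gfE; apply: (mulIr unit_radical); rewrite -[LHS]mulrA mulrVK ?unit_radical //.
have -> : (1 - z) * r = 1 + r + z - z * (1 + r) - 1 by ring.
rewrite climb_gfE.
have -> : (1 - 2 * x) * (1 + z) = 1 + z - 2 * x - 2 * x * z by ring.
by rewrite mulx_climb_gf; ring.
Qed.

Definition pow2_gf : fps rat := Fps (fun n => (2 ^ n)%:R).

(** * Closed forms *)

Lemma popularity21_gf :
  2 * (1 - 2 * x) * r * popularity_gf [:: 2; 1]%N = 1 - r.
Proof.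
(* Clearing [r ^+ 2], a polynomial, leaves a linear recurrence on coefficients. *)
have gf_rec : r ^+ 2 * popularity_gf [:: 2; 1]%N = x * (faro_gf - 1).
  have -> : r ^+ 2 * popularity_gf [:: 2; 1]%N
      = popularity_gf [:: 2; 1]%N - x * (x * popularity_gf [:: 2; 1]%N) *+ 4.
    by rewrite sqr_radical; ring.
  apply: fpsP => -[|[|n]]; rewrite fcoefB fcoefMn !fcoefXM ?fcoefB /=.
  - by rewrite popularity21_lt2 // mul0rn subr0.
  - by rewrite popularity21_lt2 // mul0rn subr0 bin0 subrr.
  have /(congr1 (fun k => k%:R : rat)) := popularity21SS n.
  by rewrite /= natrD natrM => ->; rewrite mulr_natl; lra.
apply: (mulIr unit_radical).
have -> : 2 * (1 - 2 * x) * r * popularity_gf [:: 2; 1]%N * r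
  = 2 * (1 - 2 * x) * (r ^+ 2 * popularity_gf [:: 2; 1]%N) by ring.
rewrite gf_rec.
have -> : 2 * (1 - 2 * x) * (x * (faro_gf - 1))
  = 2 * x * ((1 - 2 * x) * faro_gf) - 2 * x * (1 - 2 * x) by ring.
rewrite faro_gf_eq.
have -> : 2 * x * (1 - z) - 2 * x * (1 - 2 * x) = 4 * x ^+ 2 - 2 * x * z by ring.
have -> : (1 - r) * r = r - r ^+ 2 by ring.
by rewrite mulx_climb_gf sqr_radical; ring.
Qed.

Lemma popularity12_gf : popularity_gf [:: 1; 2]%N =
  popularity_gf [:: 2; 1]%N + pow2_gf - 2 * faro_gf + 1.
Proof.
apply: fpsP => n; rewrite mulr_natl !fcoefD fcoefN fcoefMn fcoef1 /=.
have pop_sum := popularity12 n; have closed := popularity21_closed n.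
have : (popularity [:: 1; 2] n + ('C(n, n./2) + 'C(n, n./2))
  = popularity [:: 2; 1] n + 2 ^ n + (n == 0))%N.
  (* For [n = 0], [n.-1] is truncated, which is what the constant term corrects. *)
  by case: n pop_sum closed => [|n] /=; rewrite ?bin0; lia.
move=> /(congr1 (fun k => k%:R : rat)); rewrite !natrD; lra.
Qed.

(** The series of a pattern that counts all descents but those at one end. *)
Lemma popularity_boundary_gf p :
  (popularity p 0 = 0)%N ->
  (forall n, popularity p n.+1 + 'C(n.+1, n.+1./2)
    = popularity [:: 2; 1] n.+1 + 'C(n, n./2))%N ->
  popularity_gf p = popularity_gf [:: 2; 1]%N - (1 - x) * faro_gf + 1.
Proof.
move=> pop0 popS; have -> : (1 - x) * faro_gf = faro_gf - x * faro_gf by ring.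
apply: fpsP => -[|n]; rewrite !fcoefD !fcoefN fcoefD fcoefN fcoefXM fcoef1 /=.
  by rewrite pop0 popularity21_lt2 // bin0; lra.
have /(congr1 (fun k => k%:R : rat)) := popS n; rewrite !natrD /=; lra.
Qed.

Lemma popularity132_gf : popularity_gf [:: 1; 3; 2]%N =
  popularity_gf [:: 2; 1]%N - (1 - x) * faro_gf + 1.
Proof.
apply: popularity_boundary_gf popularity132.
by have := popularity123 0; lia.
Qed.

Lemma popularity213_gf : popularity_gf [:: 2; 1; 3]%N =
  popularity_gf [:: 2; 1]%N - (1 - x) * faro_gf + 1.
Proof.
apply: popularity_boundary_gf popularity213.
by have := popularity123 0; lia.
Qed.

Lemma popularity123_gf : popularity_gf [:: 1; 2; 3]%N =
  pow2_gf + x - (1 + 2 * x) * faro_gf.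
Proof.
have -> : (1 + 2 * x) * faro_gf = faro_gf + x * faro_gf *+ 2 by ring.
apply: fpsP => n; rewrite !fcoefD fcoefN fcoefD fcoefMn fcoefXM /=.
have pop_sum := popularity123 n; have closed := popularity21_closed n.
case: n pop_sum closed => [|n] pop_sum closed.
  rewrite (_ : popularity _ 0 = 0)%N ?bin0 ?mul0rn; last lia.
  by rewrite expn0 [X in _ + X - _]mulr0n !addr0 subrr.
have e132 := popularity132 n; have e213 := popularity213 n.
have : (popularity [:: 1; 2; 3] n.+1 + ('C(n.+1, n.+1./2) + ('C(n, n./2) + 'C(n, n./2)))
  = 2 ^ n.+1 + (n.+1 == 1))%N.
  (* For length 1, the truncation in [.-2] is corrected by the term [x]. *)
  case: n pop_sum closed e132 e213 => [|n]; first by rewrite /= !bin0; lia.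
  by rewrite -[n.+2.-2%N]/n; lia.
move=> /(congr1 (fun k => k%:R : rat)); rewrite !natrD; lra.
Qed.

Lemma unit_2 : (2 : fps rat) \is a GRing.unit.
Proof. by rewrite fps_unitE. Qed.

Lemma unit_denominator : (1 - 2 * x) * (1 + r) * r \is a GRing.unit.
Proof. by rewrite !unitrM unit_1B_2x unit_1D_radical unit_radical. Qed.

Lemma pow2_gf_eq : (1 - 2 * x) * pow2_gf = 1.
Proof.
apply: fpsP => n.
rewrite mulrBl mul1r -mulrA mulr_natl fcoefB fcoefMn fcoefXM fcoef1.
case: n => [|n] /=; first by rewrite mul0rn subr0.
by rewrite expnS natrM mulr_natl subrr.
Qed.

Lemma popularity21_closed_form :
  popularity_gf [:: 2; 1]%N = (1 - r) / (2 * (1 - 2 * x) * r).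
Proof.
apply: (canRL (mulrK _)); first by rewrite !unitrM unit_2 unit_1B_2x unit_radical.
by rewrite mulrC popularity21_gf.
Qed.

Lemma popularity12_closed_form : popularity_gf [:: 1; 2]%N =
  2 * x * (-1 + 4 * x ^+ 2 + x + r) / ((1 - 2 * x) * (1 + r) * r).
Proof.
rewrite popularity12_gf; set L := popularity_gf _.
apply: (canRL (mulrK unit_denominator)); apply: (mulrI unit_2).
(* The factor 2 comes from [popularity21_gf]; each series is grouped with
   the factor of the denominator that clears it. *)
have -> : 2 * ((L + pow2_gf - 2 * faro_gf + 1) * ((1 - 2 * x) * (1 + r) * r)) =
    (1 + r) * (2 * (1 - 2 * x) * r * L + 2 * r * ((1 - 2 * x) * pow2_gf)
               - 4 * r * ((1 - 2 * x) * faro_gf) + 2 * (1 - 2 * x) * r) by ring.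
rewrite popularity21_gf pow2_gf_eq faro_gf_eq.
have -> : (1 + r) * (1 - r + 2 * r * 1 - 4 * r * (1 - z) + 2 * (1 - 2 * x) * r) =
    1 - 4 * x * r + 4 * r * (z * (1 + r)) - (1 + 4 * x) * r ^+ 2 by ring.
by rewrite climb_gfE sqr_radical; ring.
Qed.

Lemma boundary_closed_form :
  popularity_gf [:: 2; 1]%N - (1 - x) * faro_gf + 1 =
    x * (-1 + 4 * x ^+ 2 + 2 * x + (1 - 2 * x) * r) / ((1 - 2 * x) * (1 + r) * r).
Proof.
set L := popularity_gf _.
apply: (canRL (mulrK unit_denominator)); apply: (mulrI unit_2).
have -> : 2 * ((L - (1 - x) * faro_gf + 1) * ((1 - 2 * x) * (1 + r) * r)) =
    (1 + r) * (2 * (1 - 2 * x) * r * L - 2 * (1 - x) * r * ((1 - 2 * x) * faro_gf)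
               + 2 * (1 - 2 * x) * r) by ring.
rewrite popularity21_gf faro_gf_eq.
have -> : (1 + r) * (1 - r - 2 * (1 - x) * r * (1 - z) + 2 * (1 - 2 * x) * r) =
    1 - 2 * x * r + 2 * (1 - x) * r * (z * (1 + r)) - (1 + 2 * x) * r ^+ 2 by ring.
by rewrite climb_gfE sqr_radical; ring.
Qed.

Lemma popularity123_closed_form : popularity_gf [:: 1; 2; 3]%N =
  x * (1 + 2 * x) * (1 - r) / ((1 - 2 * x) * (1 + r)).
Proof.
rewrite popularity123_gf.
apply: (canRL (mulrK _)); first by rewrite unitrM unit_1B_2x unit_1D_radical.
have -> : (pow2_gf + x - (1 + 2 * x) * faro_gf) * ((1 - 2 * x) * (1 + r)) =
    (1 + r) * ((1 - 2 * x) * pow2_gf + x * (1 - 2 * x)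
               - (1 + 2 * x) * ((1 - 2 * x) * faro_gf)) by ring.
rewrite pow2_gf_eq faro_gf_eq.
have -> : (1 + r) * (1 + x * (1 - 2 * x) - (1 + 2 * x) * (1 - z)) =
    (1 + r) * (- x - 2 * x ^+ 2) + (1 + 2 * x) * (z * (1 + r)) by ring.
by rewrite climb_gfE; ring.
Qed.

End GeneratingFunctions.

Theorem corollary3p6 :
  let x : fps rat := fpsX in
  let r : fps rat := fps_sqrt (1 - 4 * x ^+ 2) in
  [/\ popularity_gf [:: 2; 1]%N = (1 - r) / (2 * (1 - 2 * x) * r),
      popularity_gf [:: 1; 2]%N =
        2 * x * (-1 + 4 * x ^+ 2 + x + r) / ((1 - 2 * x) * (1 + r) * r),
      popularity_gf [:: 1; 3; 2]%N =
        x * (-1 + 4 * x ^+ 2 + 2 * x + (1 - 2 * x) * r)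
          / ((1 - 2 * x) * (1 + r) * r),
      popularity_gf [:: 2; 1; 3]%N =
        x * (-1 + 4 * x ^+ 2 + 2 * x + (1 - 2 * x) * r)
          / ((1 - 2 * x) * (1 + r) * r)
    & popularity_gf [:: 1; 2; 3]%N =
        x * (1 + 2 * x) * (1 - r) / ((1 - 2 * x) * (1 + r))].
Proof.
split.
- exact: popularity21_closed_form.
- exact: popularity12_closed_form.
- by rewrite popularity132_gf boundary_closed_form.
- by rewrite popularity213_gf boundary_closed_form.
- exact: popularity123_closed_form.
Qed.
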